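(* Let $L$ be a lattice which has the unary interpolation property ($1$-IP). Let $\kappa$ be the cardinality of $L$ and assume that $\kappa$ is a strong limit cardinal of uncountable cofinality. Then for some natural number $n$ there is an antichain $A\subseteq L^n$ of cardinality $\kappa$.
   Context: The base theory is ZFC. A polynomial of a lattice $L$ is a lattice term (built from variables with $\vee,\wedge$) in which some variables may be replaced by elements (coefficients) of $L$; it induces a function on $L$. A lattice $L$ has the unary interpolation property ($1$-IP) if every monotone function $f:L\to L$ can be interpolated by a polynomial on any finite set, i.e. for every monotone $f:L\to L$ and every finite $F\subseteq L$ there is a unary polynomial $p$ with coefficients in $L$ such that $p(x)=f(x)$ for all $x\in F$. (Equivalently: whenever $a,b,c,d\in L$, $b\not\le a$, $c\le d$, there is a unary polynomial $p$ with $p(a)=c$, $p(b)=d$.) The power $L^n$ is ordered coordinatewise; an antichain is a set of pairwise incomparable elements. *)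

(* Defs.v *)
From mathcomp Require Import all_boot all_order.
From mathcomp Require Import boolp classical_sets functions cardinality.
From mathcomp Require wochoice.

Set Implicit Arguments.
Unset Strict Implicit.
Unset Printing Implicit Defensive.

Local Open Scope classical_set_scope.
Local Open Scope card_scope.

Section Polynomials.
Context {d : Order.disp_t} (L : latticeType d).

Inductive lattice_poly (n : nat) : Type :=
| PVar of 'I_n
| PCoef of L
| PMeet of lattice_poly n & lattice_poly n
| PJoin of lattice_poly n & lattice_poly n.

Fixpoint peval n (p : lattice_poly n) (v : 'I_n -> L) : L :=
  match p with
  | PVar i => v i
  | PCoef a => a
  | PMeet q r => Order.meet (peval q v) (peval r v)
  | PJoin q r => Order.join (peval q v) (peval r v)
  end.

Definition unary_interpolation_property : Prop :=
  forall f : L -> L, Order.nondecreasing f ->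
  forall F : set L, finite_set F ->
  exists p : lattice_poly 1, forall x, F x -> peval p (fun=> x) = f x.

End Polynomials.

Definition antichain {d : Order.disp_t} {T : porderType d} (A : set T) : Prop :=
  forall x y, A x -> A y -> x <> y -> ~~ Order.comparable x y.

Definition card_lt T U (A : set T) (B : set U) : Prop :=
  (A #<= B) /\ (A #!= B).

(* A cardinal is an initial ordinal: a well-ordered type, with reflexive order
   [cle], all of whose proper initial segments have smaller cardinality. *)
Record cardinal := Cardinal {
  cardinal_sort :> Type;
  cle : rel cardinal_sort;
  cle_well_order : wochoice.well_order cle;
  cle_initial : forall x : cardinal_sort,
    card_lt [set y | cle y x /\ y <> x] [set: cardinal_sort]
}.

Definition has_cardinality T (A : set T) (kappa : cardinal) : Prop :=
  A #= [set: kappa].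

(* Every cardinal lambda < kappa is the cardinality of some S : set kappa, and
   then 2 ^ lambda is the cardinality of the power set of S. *)
Definition strong_limit (kappa : cardinal) : Prop :=
  infinite_set [set: kappa] /\
  forall S : set kappa, card_lt S [set: kappa] ->
    card_lt [set X : set kappa | X `<=` S] [set: kappa].

Definition cofinal (kappa : cardinal) (C : set kappa) : Prop :=
  forall x : kappa, exists2 y, C y & cle x y.

(* The cofinality of kappa is the least cardinality of a cofinal subset. *)
Definition uncountable_cofinality (kappa : cardinal) : Prop :=
  forall C : set kappa, cofinal C -> ~ countable C.

(* Main.v *)
Require Import Defs.
From mathcomp Require Import all_boot all_order.
From mathcomp Require Import boolp classical_sets functions cardinality.

(** A polynomial is increasing in its coefficients: if two polynomials have the
    same underlying term and the coefficients of the first are below those of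
    the second, then the first induces the smaller function.  So a large family
    of polynomials with a common term, forced to be pairwise incomparable by
    their values at a few points, gives a large antichain of coefficient tuples.

    To force incomparability, fix c < e in L and choose kappa many pairs
    (a i, b i) with b i not below a i such that, for i <> j,

      (X)  a i <= a j and b i <= b j imply b i <= a j.

    By interpolation there is a polynomial p i with p i (a i) = c and
    p i (b i) = e.  There are only countably many terms and the cofinality of
    kappa is uncountable, so kappa many of the p i have the same term
    ([countable_pigeonhole]).  For these i the tuples

      (a i, b i, coefficients of p i)

    form an antichain: if the i-th tuple is below the j-th one and i <> j, then
    b i <= a j by (X), and

      e = p i (b i) <= p j (b i) <= p j (a j) = c,

    which is false.

    The pairs are found by transfinite recursion ([noncrossing_pairs]).  At stage
    i there are fewer than kappa previous pairs, and as kappa is a strong limit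
    there are fewer than kappa ways in which an element of L can be related to
    all their coordinates.  So two distinct elements x and y are related to them
    in the same way; say x is not below y.  Then a i = y and b i = x work,
    because b j <= b i gives b j <= a i, and a i <= a j gives b i <= a j, for
    every earlier j. *)

Set Implicit Arguments.
Unset Strict Implicit.
Unset Printing Implicit Defensive.

Import Order.TTheory.

Local Open Scope classical_set_scope.
Local Open Scope card_scope.

(** * Comparing cardinalities by injections *)

Lemma card_le_of_inj {T U : Type} {A : set T} {B : set U} (f : T -> U) :
  set_fun A B f -> set_inj A f -> A #<= B.
Proof.
move=> fAB fI; have /injfunPex[g] : exists2 f : T -> U, set_fun A B f & set_inj A f.
  by exists f.
exact: inj_card_le g.
Qed.

Lemma inj_of_card_le {T U : Type} {A : set T} {B : set U} (u0 : U) :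
  A #<= B -> exists2 f : T -> U, set_fun A B f & set_inj A f.
Proof.
move=> /card_leP[g].
pose f x := if pselect (A x) is left Ax then set_val (g (SigSub (mem_set Ax)))
            else u0.
exists f => [x Ax|x y /set_mem Ax /set_mem Ay]; rewrite /f.
  by case: pselect => // Ax'; apply: set_valP.
case: pselect => // Ax'; case: pselect => // Ay'.
by move=> /val_inj /inj /= => /(_ (in_setT _) (in_setT _)) /(congr1 val).
Qed.

Lemma card_le_powerset {T U : Type} {A : set T} {B : set U} (u0 : U) :
  A #<= B -> [set X | X `<=` A] #<= [set Y | Y `<=` B].
Proof.
move=> /(inj_of_card_le u0)[f fAB fI].
apply: (@card_le_of_inj _ _ _ _ (fun X => f @` X)) => [X XA _ [x Xx <-]|X Y].
  exact/fAB/XA.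
move=> /set_mem XA /set_mem YA fXY.
have sub (X' Y' : set T) : X' `<=` A -> Y' `<=` A -> f @` X' = f @` Y' ->
    X' `<=` Y'.
  move=> XA' YA' e x X'x; have : (f @` X') (f x) by exists x.
  rewrite e => -[y Y'y] /fI.
  by rewrite !inE => <- //; [exact: YA'|exact: XA'].
by apply/seteqP; split; apply: sub.
Qed.

(** The ordered pair as a set of sets, which embeds the square of a set into its
    double power set. *)
Definition kuratowski {T : Type} (x y : T) : set (set T) := [set [set x]; [set x; y]].

Lemma kuratowski_inj {T : Type} (x y x' y' : T) :
  kuratowski x y = kuratowski x' y' -> x = x' /\ y = y'.
Proof.
move=> e.
have ex : x = x'.
  have : kuratowski x' y' [set x] by rewrite -e; left.
  case=> [exx|exx].
    have : [set x'] x by rewrite -exx.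
    by [].
  have : [set x] x' by rewrite exx; left.
  by move=> ->.
split=> //; rewrite -ex in e.
have [exy|exy] : kuratowski x y' [set x; y] by rewrite -e; right.
  have yx : y = x by have : [set x] y by rewrite -exy; right.
  have [exy'|exy'] : kuratowski x y [set x; y'] by rewrite e; right.
    have : [set x] y' by rewrite -exy'; right.
    by rewrite yx => ->.
  have : [set x; y] y' by rewrite -exy'; right.
  by rewrite yx => -[] ->.
have [yx|//] : [set x; y'] y by rewrite -exy; right.
have [y'x|->//] : [set x; y] y' by rewrite exy; right.
by rewrite yx y'x.
Qed.

(** * Sets smaller than a strong limit cardinal of uncountable cofinality *)

Section Cardinal.
Context (kappa : cardinal).
Implicit Types x y z : kappa.

Definition segment x : set kappa := [set y | cle y x /\ y <> x].

Lemma set_minimum (A : set kappa) : A !=set0 ->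
  exists2 x, A x & forall y, A y -> cle x y.
Proof.
move=> [y Ay]; have [|x [[Ax xA] _]] := @cle_well_order kappa (mem A).
  by exists y; apply/mem_set.
by exists x => [|z Az]; [exact: set_mem|apply: xA; apply/mem_set].
Qed.

Lemma cle_total x y : cle x y \/ cle y x.
Proof.
have [|z zxy zmin] := @set_minimum [set x; y]; first by exists x; left.
by case: zxy zmin => -> zmin; [left|right]; apply: zmin; [right|left].
Qed.

Lemma cle_refl x : cle x x.
Proof. by case: (cle_total x x). Qed.

Lemma cle_anti x y : cle x y -> cle y x -> x = y.
Proof.
move=> xy yx; have [|z [_ zuniq]] := @cle_well_order kappa (mem [set x; y]).
  by exists x; apply/mem_set; left.
have min w : [set x; y] w -> z = w.
  move=> wxy; apply: zuniq; split; first exact/mem_set.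
  by move=> v /set_mem; case: wxy => ->; case=> ->; rewrite ?cle_refl.
by transitivity z; [apply/esym|]; apply: min; [left|right].
Qed.

Lemma segment_wf : well_founded (fun y x => segment x y).
Proof.
move=> x; apply: contrapT => nx.
have [y ny ymin] := @set_minimum [set y | ~ Acc (fun y x => segment x y) y]
  (ex_intro _ x nx).
apply: ny; split=> z [zy zNy]; apply: contrapT => nz.
exact/zNy/cle_anti/ymin.
Qed.

Lemma cle_trans x y z : cle x y -> cle y z -> cle x z.
Proof.
move=> xy yz.
have [w] := @set_minimum [set x; y; z] (ex_intro _ x (or_introl (or_introl erefl))).
case=> [[]|] -> le_w.
- by apply: le_w; right.
- by rewrite (cle_anti xy) //; apply: le_w; left; left.
- have <- : y = z by apply: cle_anti => //; apply: le_w; left; right.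
  exact: xy.
Qed.

Lemma segment_sub x y : cle x y -> segment x `<=` segment y.
Proof.
move=> xy z [zx zNx]; split; first exact: cle_trans xy.
by move=> zy; apply: zNx; apply: cle_anti => //; rewrite zy.
Qed.

Lemma segment_total x y : x <> y -> segment x y \/ segment y x.
Proof.
by move=> xy; have [le|le] := cle_total x y; [right|left]; split=> // /esym.
Qed.

(** Recursive choice in which the constraint at stage [x] involves only the set of
    values chosen at earlier stages; constraints of this form suffice both for
    injections out of [kappa] and for the pairs of [noncrossing_pairs]. *)
Lemma transfinite_choice {V : Type} (v0 : V) (next : set V -> V -> Prop) :
  (forall x (g : kappa -> V), exists v, next (g @` segment x) v) ->
  exists g : kappa -> V, forall x, next (g @` segment x) (g x).
Proof.
move=> ex.
pose pick (S : set V) : V :=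
  if pselect (exists v, next S v) is left nextS then projT1 (cid nextS) else v0.
pose step x (rec : forall y, segment x y -> V) : V :=
  pick [set v | exists y (yx : segment x y), rec y yx = v].
pose g := Fix segment_wf (fun=> V) step.
have gE x : g x = pick (g @` segment x).
  rewrite {1}/g Fix_eq => [|{}x r r' rr'].
    congr pick; apply/seteqP; split=> v.
      by move=> [y [yx <-]]; exists y.
    by move=> [y yx <-]; exists y, yx.
  by congr step; apply: functional_extensionality_dep => y;
    apply: functional_extensionality_dep.
exists g => x; rewrite [X in next _ X]gE /pick.
by case: pselect => [nextS|[]]; [exact: projT2 (cid nextS)|exact: ex].
Qed.

(** By comparability of cardinals this says that the cardinality of [A] is less
    than [kappa]; the negative form is the one in which pigeonhole arguments use
    it, and [small_le_segment] gives the positive one. *)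
Definition small {T : Type} (A : set T) := ~ ([set: kappa] #<= A).

Lemma small_le {T U : Type} {A : set T} {B : set U} :
  A #<= B -> small B -> small A.
Proof. by move=> AB + kA; apply; apply: card_le_trans AB. Qed.

Lemma small_segment x : small (segment x).
Proof.
move=> kx; have [_ /negP] := cle_initial x; apply; apply/card_eqPle.
by rewrite kx card_leT.
Qed.

(** If [A] embeds in no segment, then no segment is enough to exhaust [A], so
    choosing new elements of [A] one after another embeds [kappa] in [A]. *)
Lemma small_le_segment {T : Type} (A : set T) : small A -> exists x, A #<= segment x.
Proof.
move=> smallA; apply: contrapT => no; apply: (smallA).
have Nle x : ~ (A #<= segment x) by move=> Ax; apply: no; exists x.
have [x0] : [set: kappa] !=set0.
  by apply/set0P/eqP => k0; apply: (smallA); rewrite k0 card_ge0.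
move=> _.
have [v0 Av0] : A !=set0.
  by apply/set0P/eqP => A0; apply: (Nle x0); rewrite A0 card_ge0.
have [|g gP] := @transfinite_choice _ v0 (fun S v => A v /\ ~ S v).
  move=> x g; apply: contrapT => nov; apply: (Nle x).
  apply: (@card_le_trans _ _ _ (g @` segment x)); last exact: card_image_le.
  apply: subset_card_le => v Av; apply: contrapT => Nv.
  by apply: nov; exists v.
apply: (@card_le_of_inj _ _ _ _ g) => [x _|x y _ _ gxy]; first by case: (gP x).
apply: contrapT => /segment_total[yx|xy].
  by case: (gP x) => _; apply; exists y.
by case: (gP y) => _; apply; exists x.
Qed.

Hypothesis strong : strong_limit kappa.

Lemma small_powerset {T : Type} (A : set T) : small A -> small [set X | X `<=` A].
Proof.
move=> /small_le_segment[x Ax]; apply: (small_le (card_le_powerset x Ax)) => kx.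
have [|Pk /negP] := strong.2 (segment x); first exact: cle_initial.
by apply; apply/card_eqPle.
Qed.

(** Both factors embed in one segment, whose square embeds in its double power
    set by [kuratowski]; this is small by two applications of the strong limit
    property. *)
Lemma small_setX {T U : Type} (A : set T) (B : set U) :
  small A -> small B -> small (A `*` B).
Proof.
move=> /small_le_segment[x Ax] /small_le_segment[y By].
have [z [xz yz]] : exists z, segment x `<=` segment z /\ segment y `<=` segment z.
  by case: (cle_total x y) => le; [exists y|exists x]; split=> //; apply: segment_sub.
have [f fA fI] := inj_of_card_le x (card_le_trans Ax (subset_card_le xz)).
have [g gB gI] := inj_of_card_le x (card_le_trans By (subset_card_le yz)).
have := small_powerset (small_powerset (@small_segment z)); apply: small_le.
apply: (@card_le_of_inj _ _ _ _ (fun u => kuratowski (f u.1) (g u.2))).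
  move=> [u v] [/= Au Bv] X [->|->] w /=; first by move=> ->; apply: fA.
  by move=> [->|->]; [apply: fA|apply: gB].
move=> [u v] [u' v'] /set_mem[/= Au Bv] /set_mem[/= Au' Bv'].
by move=> e; have [fu gv] := kuratowski_inj e; congr pair; [apply: fI|apply: gI]; rewrite ?inE.
Qed.

Hypothesis cof : uncountable_cofinality kappa.

(** A countable [kappa] would be a countable cofinal subset of itself. *)
Lemma small_countable {T : Type} (A : set T) : countable A -> small A.
Proof.
move=> cA kA; apply: (cof (C := [set: kappa])); last exact: card_le_trans cA.
by move=> x; exists x => //; apply: cle_refl.
Qed.

(** If all fibres were small, each would embed in a segment, and by uncountable
    cofinality all in the same segment; then [kappa] would embed in the product
    of a countable set and this segment. *)
Lemma countable_pigeonhole {C : countType} (f : kappa -> C) :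
  exists c, ~ small (f @^-1` [set c]).
Proof.
apply: contrapT => no.
have /choice[x fx] : forall c, exists x, f @^-1` [set c] #<= segment x.
  by move=> c; apply: small_le_segment => sc; apply: no; exists c.
have [z zx] : exists z, forall c, segment (x c) `<=` segment z.
  apply: contrapT => noz; apply: (cof (C := range x)).
    move=> z; apply: contrapT => nz; apply: noz; exists z => c.
    apply: segment_sub; have [//|zxc] := cle_total (x c) z.
    by case: nz; exists (x c).
  exact: card_le_trans (card_image_le _ _) (countableP _).
have /choice[h hP] : forall c, exists h : kappa -> kappa,
    set_fun (f @^-1` [set c]) (segment z) h /\ set_inj (f @^-1` [set c]) h.
  move=> c.
  have /(inj_of_card_le z)[h ? ?] := card_le_trans (fx c) (subset_card_le (zx c)).
  by exists h.
apply: (small_setX (small_countable (countableP [set: C])) (@small_segment z)).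
apply: (@card_le_of_inj _ _ _ _ (fun i => (f i, h (f i) i))).
  by move=> i _; split=> //=; apply: (hP (f i)).1.
move=> i j _ _ [fij]; rewrite fij.
by apply: (hP (f j)).2; rewrite inE.
Qed.

Lemma not_small_card_eq (K : set kappa) : ~ small K -> K #= [set: kappa].
Proof. by move=> /contrapT kK; apply/card_eqPle; rewrite card_leT. Qed.

(** In a linear order the last condition makes any two intervals ]a i, b i]
    disjoint or nested.  It is obtained from the choice of two elements with the
    same trace: the sets of earlier stages whose upper point is below, and
    whose lower point is above, a given element. *)
Lemma noncrossing_pairs {d : Order.disp_t} (P : porderType d) (P_card : ~ small [set: P]) :
  exists a b : kappa -> P,
    (forall i, ~~ (b i <= a i)%O) /\
    (forall i j, i <> j -> (a i <= a j)%O -> (b i <= b j)%O -> (b i <= a j)%O).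
Proof.
have [x0 _] : [set: P] !=set0.
  apply/set0P/eqP => P0; apply: P_card; rewrite P0.
  apply: small_countable; exact: countable0.
pose next (S : set (P * P)) v := ~~ (v.2 <= v.1)%O /\ forall u, S u ->
  ((u.2 <= v.2)%O -> (u.2 <= v.1)%O) /\ ((v.1 <= u.1)%O -> (v.2 <= u.1)%O).
have [|g gP] := @transfinite_choice _ (x0, x0) next.
  move=> i g; apply: contrapT => stuck; apply: P_card.
  pose trace (x : P) := ([set j | segment i j /\ ((g j).2 <= x)%O],
                   [set j | segment i j /\ (x <= (g j).1)%O]).
  have subsets_small := small_powerset (@small_segment i).
  apply: small_le (small_setX subsets_small subsets_small); apply: (@card_le_of_inj _ _ _ _ trace).
    by move=> x _; split=> j [].
  have trace_le (x y : P) : trace x = trace y -> (x <= y)%O.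
    (* otherwise (y, x) is an admissible value at stage i *)
    move=> [below above]; apply: contrapT => /negP xy.
    apply: stuck; exists (y, x); split=> // _ [j ji <-]; split=> /= le.
      have : [set j | segment i j /\ ((g j).2 <= x)%O] j by [].
      by rewrite below => -[].
    have : [set j | segment i j /\ (y <= (g j).1)%O] j by [].
    by rewrite -above => -[].
  by move=> x y _ _ xy; apply/le_anti; rewrite !trace_le.
exists (fun i => (g i).1), (fun i => (g i).2); split=> [i|i j ij aij bij].
  by case: (gP i).
have [ji|ij'] := segment_total ij.
  by have [_ /(_ (g j))[|_]] := gP i; [exists j|apply].
by have [_ /(_ (g i))[|+ _]] := gP j; [exists i|apply].
Qed.

End Cardinal.

(** * Polynomials with the same underlying term *)

Section Polynomials.
Context {d : Order.disp_t} {L : latticeType d}.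

(** The step function that jumps from [c] to [e] on the principal filter of [b]
    is monotone. *)
Lemma separating_poly (L_1IP : unary_interpolation_property L) (a b c e : L) :
  ~~ (b <= a)%O -> (c <= e)%O ->
  exists p : lattice_poly L 1, peval p (fun=> a) = c /\ peval p (fun=> b) = e.
Proof.
move=> ba ce; pose f x := if (b <= x)%O then e else c.
have f_mono : Order.nondecreasing f.
  move=> x y xy; rewrite /f; case: (boolP (b <= x)%O) => [bx|_].
    by rewrite (le_trans bx xy).
  by case: ifP.
have [p pf] := L_1IP f f_mono [set a; b] (finite_set2 a b).
exists p; rewrite !pf /f ?(negbTE ba) ?lexx //; [by right|by left].
Qed.

Fixpoint coefs n (p : lattice_poly L n) : seq L :=
  match p with
  | PVar _ => [::]
  | PCoef a => [:: a]
  | PMeet q r | PJoin q r => coefs q ++ coefs r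
  end.

(** The underlying term, with all coefficients forgotten; as a [GenTree.tree] it
    lives in a countable type. *)
Fixpoint shape n (p : lattice_poly L n) : GenTree.tree 'I_n :=
  match p with
  | PVar i => GenTree.Leaf i
  | PCoef _ => GenTree.Node 0 [::]
  | PMeet q r => GenTree.Node 1 [:: shape q; shape r]
  | PJoin q r => GenTree.Node 2 [:: shape q; shape r]
  end.

Lemma shape_size_coefs n (p q : lattice_poly L n) :
  shape p = shape q -> size (coefs p) = size (coefs q).
Proof.
elim: p q => [i|a|p1 IH1 p2 IH2|p1 IH1 p2 IH2] [j|b|q1 q2|q1 q2] //= [e1 e2].
- by rewrite !size_cat (IH1 q1) ?(IH2 q2).
- by rewrite !size_cat (IH1 q1) ?(IH2 q2).
Qed.

Lemma peval_le_coefs n (x0 : L) (p q : lattice_poly L n) v :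
  shape p = shape q ->
  (forall k, (nth x0 (coefs p) k <= nth x0 (coefs q) k)%O) ->
  (peval p v <= peval q v)%O.
Proof.
have cat_le (s1 s2 t1 t2 : seq L) : size s1 = size t1 ->
    (forall k, (nth x0 (s1 ++ s2) k <= nth x0 (t1 ++ t2) k)%O) ->
    (forall k, (nth x0 s1 k <= nth x0 t1 k)%O) /\
    (forall k, (nth x0 s2 k <= nth x0 t2 k)%O).
  move=> st le; split=> k.
    have [ks|sk] := ltnP k (size s1).
      by have := le k; rewrite !nth_cat -st ks.
    by rewrite !nth_default -?st.
  by have := le (size s1 + k)%N; rewrite !nth_cat -st ltnNge leq_addr addKn.
elim: p q => [i|a|p1 IH1 p2 IH2|p1 IH1 p2 IH2] [j|b|q1 q2|q1 q2] //=.
- by move=> [->].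
- by move=> _ /(_ 0%N).
- move=> [e1 e2] /cat_le[|le1 le2]; first exact: shape_size_coefs.
  by apply: leI2; [apply: IH1|apply: IH2].
- move=> [e1 e2] /cat_le[|le1 le2]; first exact: shape_size_coefs.
  by apply: leU2; [apply: IH1|apply: IH2].
Qed.

Lemma peval_mono n (p : lattice_poly L n) v w :
  (forall i, (v i <= w i)%O) -> (peval p v <= peval p w)%O.
Proof.
move=> vw; elim: p => //= q IHq r IHr; first exact: leI2.
exact: leU2.
Qed.

End Polynomials.

(** * Antichains in powers *)

Theorem theorem1p2 (d : Order.disp_t) (L : latticeType d) (kappa : cardinal)
  (L_1IP : unary_interpolation_property L)
  (L_card : has_cardinality [set: L] kappa)
  (kappa_strong_limit : strong_limit kappa)
  (kappa_cof : uncountable_cofinality kappa) :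
  exists (n : nat) (A : set (n.-tupleprod L)),
    antichain A /\ has_cardinality A kappa.
Proof.
have L_large : ~ small kappa [set: L].
  by apply; case/card_eqPle: L_card.
have [a [b [ba ab]]] := noncrossing_pairs kappa_strong_limit kappa_cof L_large.
have [i0 _] : [set: kappa] !=set0.
  by apply/set0P/eqP => k0; apply: kappa_strong_limit.1; rewrite k0.
pose e := b i0; pose c := (a i0 `&` e)%O.
have ce : (c <= e)%O by apply: leIr.
have ec : ~~ (e <= c)%O by rewrite lexI lexx andbT; apply: ba.
have /choice[p pP] i := separating_poly L_1IP (ba i) ce.
have [s /not_small_card_eq K_card] :=
  countable_pigeonhole kappa_strong_limit kappa_cof (fun i => shape (p i)).
set K := _ @^-1` _ in K_card.
have [n nP] : exists n, forall i, K i -> size (coefs (p i)) = n.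
  have [[j Kj]|K0] := pselect (K !=set0); last first.
    by exists 0%N => i Ki; case: K0; exists i.
  exists (size (coefs (p j))) => i Ki; apply: shape_size_coefs.
  by rewrite Ki Kj.
pose word i := a i :: b i :: coefs (p i).
pose t i : n.+2.-tupleprod L := [tuple nth c (word i) k | k < n.+2].
have t_le i j : K i -> K j -> (t i <= t j)%O -> i = j.
  move=> Ki Kj; rewrite leEtprod => /forallP tij.
  have word_le k : (nth c (word i) k <= nth c (word j) k)%O.
    have [kn|nk] := ltnP k n.+2.
      by have := tij (Ordinal kn); rewrite !tnth_mktuple.
    by rewrite !nth_default //= nP.
  apply: contrapT => ij; move/negP: ec; apply.
  have b_le : (b i <= a j)%O.
    by apply: (ab _ _ ij); [apply: (word_le 0%N)|apply: (word_le 1%N)].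
  rewrite -(pP i).2 -(pP j).1.
  apply: (@le_trans _ _ (peval (p j) (fun=> b i))).
    apply: (@peval_le_coefs _ _ _ c); first by rewrite Ki Kj.
    by move=> k; apply: (word_le k.+2).
  exact: peval_mono.
exists n.+2, (t @` K); split.
  move=> _ _ [i Ki <-] [j Kj <-] tij; apply/negP => /orP[/t_le|/t_le] ij.
    by apply: tij; rewrite ij.
  by apply: tij; rewrite -ij.
apply: card_eq_trans K_card; apply: inj_card_eq => i j /set_mem Ki /set_mem Kj tij.
by apply: t_le => //; rewrite tij.
Qed.
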